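(* Let $X$ be a locally finite partially ordered set, $F$ a field, $A=I(X,F)$ the incidence algebra and $C=\mathrm{Co}(X,F)$ the incidence coalgebra. Then: 1. $$\mathrm{Der}\,C=\mathrm{In}(\mathrm{Der}\,C)+\mathrm{Add}\,C=\mathrm{In}_1(\mathrm{Der}\,C)\oplus\mathrm{Add}\,C.$$ 2. The derivation spaces $\mathrm{Der}\,C$ and $\mathrm{Der}\,A$ are isomorphic.
   Context: Locally finite means that every interval $[x,y]=\{z\in X\mid x\le z\le y\}$ ($x\le y$) is finite. Incidence coalgebra $C=\mathrm{Co}(X,F)$: the $F$-space with basis all intervals $[x,y]$, $x\le y$ in $X$, with comultiplication $\Delta([x,y])=\sum_{x\le z\le y}[x,z]\otimes[z,y]$ and counit $\varepsilon([x,y])=1$ if $x=y$, $0$ otherwise. A derivation of $C$ is a linear map $d:C\to C$ with $\Delta d=(d\otimes1)\Delta+(1\otimes d)\Delta$; $\mathrm{Der}\,C$ is the $F$-space of all of them. Incidence algebra $A=I(X,F)$: functions $f:X\times X\to F$ with $f(x,y)=0$ unless $x\le y$, with pointwise linear operations and product $(fg)(x,y)=\sum_{x\le z\le y}f(x,z)g(z,y)$. $\mathrm{Der}\,A$ is the $F$-space of $F$-linear maps $d:A\to A$ with $d(ab)=d(a)b+ad(b)$. Dual algebra: $C^*=\mathrm{Hom}_F(C,F)$ with product $(\chi\circ\xi)(c)=\sum_i\chi(a_i)\xi(b_i)$ if $\Delta(c)=\sum_i a_i\otimes b_i$, and identity $\varepsilon$. There are mutually inverse algebra isomorphisms $\Phi:C^*\to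 A$, $\Phi(\chi)(x,y)=\chi([x,y])$ and $\Psi:A\to C^*$, $\Psi(f)([x,y])=f(x,y)$. For $\varphi\in\mathrm{End}_FC$ let $\varphi^*:C^*\to C^*$, $\varphi^*(\chi)=\chi\varphi$. Define $\Theta:\mathrm{End}_FC\to\mathrm{End}_FA$ by $\Theta(\varphi)=\Phi\varphi^*\Psi$; it restricts to an injective linear map $\mathrm{Der}\,C\to\mathrm{Der}\,A$. For an algebra $R$ and $c\in R$, the inner derivation determined by $c$ is $d_c(a)=ac-ca$. Let $M_1=\{f\in A\mid f(x,x)=0\text{ for all }x\}$; $\mathrm{In}_1(\mathrm{Der}\,A)$ is the space of inner derivations of $A$ determined by elements of $M_1$. $\mathrm{In}(\mathrm{Der}\,C)$ is the space of those $\nu\in\mathrm{Der}\,C$ for which $\nu^*$ is an inner derivation of the algebra $C^*$; $\mathrm{In}_1(\mathrm{Der}\,C)=\Theta^{-1}(\mathrm{In}_1(\mathrm{Der}\,A))$ (preimage in $\mathrm{Der}\,C$). An additive system is a family $\{c_{xy}\in F\mid x<y\}$ with $c_{xy}=c_{xz}+c_{zy}$ whenever $x<z<y$. $\mathrm{Add}\,C$ is the space of derivations $\lambda$ of $C$ of the form $\lambda([x,y])=c_{xy}[x,y]$ for $x<y$, $\lambda([x,x])=0$, for additive systems $\{c_{xy}\}$. *)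

(* Defs.v *)
From HB Require Import structures.
From mathcomp Require Import all_boot all_order all_algebra.
From mathcomp Require Import all_classical.
From mathcomp Require Import prodnormedzmodule.
From mathcomp.multinomials Require Import freeg.

Set Implicit Arguments.
Unset Strict Implicit.
Unset Printing Implicit Defensive.

Import Order.TTheory GRing.Theory.

Local Open Scope classical_set_scope.
Local Open Scope ring_scope.

HB.mixin Record isLocallyFinite (d : Order.disp_t) X of Order.POrder d X := {
  locally_finite : forall x y : X, finite_set `[x, y]
}.

#[short(type="locallyFinitePOrderType")]
HB.structure Definition LocallyFinitePOrder (d : Order.disp_t) :=
  {X of Order.POrder d X & isLocallyFinite d X}.

Section LinearMaps.
Variables (F : fieldType) (U V : lmodType F).
Implicit Types (k : F) (f g h : {linear U -> V}).

Lemma linear_ext f g : f =1 g -> f = g.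
Proof.
case: f g => f [[fs] [fz]] [g [[gs] [gz]]] /= fg.
have {}fg : f = g by apply/funext.
by subst g; congr (GRing.Linear.Pack (GRing.Linear.Class _ _));
  congr (_ _); apply: Prop_irrelevance.
Qed.

Definition linear_zero : {linear U -> V} := \0.
Definition linear_add f g : {linear U -> V} := f \+ g.
Definition linear_opp f : {linear U -> V} := \- f.
Definition linear_scale k f : {linear U -> V} := k \*: f.

Fact linear_addA : associative linear_add.
Proof. by move=> f g h; apply: linear_ext => u /=; rewrite addrA. Qed.
Fact linear_addC : commutative linear_add.
Proof. by move=> f g; apply: linear_ext => u /=; rewrite addrC. Qed.
Fact linear_add0 : left_id linear_zero linear_add.
Proof. by move=> f; apply: linear_ext => u /=; rewrite add0r. Qed.
Fact linear_addN : left_inverse linear_zero linear_opp linear_add.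
Proof. by move=> f; apply: linear_ext => u /=; rewrite addNr. Qed.

HB.instance Definition _ := GRing.isZmodule.Build {linear U -> V}
  linear_addA linear_addC linear_add0 linear_addN.

Fact linear_scaleA k l f :
  linear_scale k (linear_scale l f) = linear_scale (k * l) f.
Proof. by apply: linear_ext => u /=; rewrite scalerA. Qed.
Fact linear_scale1 : left_id 1 linear_scale.
Proof. by move=> f; apply: linear_ext => u /=; rewrite scale1r. Qed.
Fact linear_scaleDr : right_distributive linear_scale +%R.
Proof. by move=> k f g; apply: linear_ext => u /=; rewrite scalerDr. Qed.
Fact linear_scaleDl f : {morph linear_scale^~ f : k l / k + l}.
Proof. by move=> k l; apply: linear_ext => u /=; rewrite scalerDl. Qed.

HB.instance Definition _ := GRing.Zmodule_isLmodule.Build F {linear U -> V}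
  linear_scaleA linear_scale1 linear_scaleDr linear_scaleDl.

Lemma linearDE f g u : (f + g) u = f u + g u. Proof. by []. Qed.
Lemma linear0E u : (0 : {linear U -> V}) u = 0. Proof. by []. Qed.
Lemma linearZE k f u : (k *: f) u = k *: f u. Proof. by []. Qed.

End LinearMaps.

Definition inner (R : pzRingType) (c a : R) : R := a * c - c * a.

Section FreeModule.
Variables (F : fieldType) (K : choiceType) (M : lmodType F).

Lemma freegUZ k (x : K) : << k *g x >> = k *: << x >> :> {freeg K / F}.
Proof. by apply/eqP/freeg_eqP => y; rewrite coeffZ !coeffU mul1r. Qed.

HB.instance Definition _ (f : K -> M) :=
  GRing.isZmodMorphism.Build {freeg K / F} M (fglift f) (lift_is_additive f).

Fact fglift_is_scalable (f : K -> M) : scalable (fglift f : {freeg K / F} -> M).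
Proof.
move=> k u.
have -> : k *: u = \sum_(z <- dom u) << k * coeff z u *g z >> by [].
rewrite -[in RHS](freeg_sumE u) !raddf_sum.
by apply: eq_bigr => z _; rewrite /= !liftU scalerA.
Qed.

HB.instance Definition _ (f : K -> M) :=
  GRing.isScalable.Build F {freeg K / F} M *:%R (fglift f)
    (fglift_is_scalable f).

Lemma fglift1 (f : K -> M) x : fglift f << x >> = f x.
Proof. by rewrite liftU scale1r. Qed.

Lemma freeg_ext (f g : {linear {freeg K / F} -> M}) :
  (forall x, f << x >> = g << x >>) -> f = g.
Proof.
move=> fg; apply: linear_ext => u.
rewrite -(freeg_sumE u) !raddf_sum; apply: eq_bigr => z _.
by rewrite /= freegUZ !linearZ_LR fg.
Qed.

End FreeModule.

Section Incidence.
Variables (d : Order.disp_t) (X : locallyFinitePOrderType d) (F : fieldType).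

(* F^o provides the pointwise F-space structure on functions. *)
Definition incident : {pred X * X -> F^o} :=
  fun f => `[< forall x y, ~~ (x <= y)%O -> f (x, y) = 0 >].

Fact incident_submod_closed : submod_closed incident.
Proof.
split=> [|k f g /asboolP fP /asboolP gP]; apply/asboolP => x y xy //.
by rewrite !fctE fP // gP // scaler0 addr0.
Qed.

HB.instance Definition _ :=
  GRing.isSubmodClosed.Build F (X * X -> F^o) incident incident_submod_closed.

Record incidenceAlg := IncidenceAlg {
  incidence_fun :> X * X -> F^o;
  _ : incidence_fun \in incident
}.

HB.instance Definition _ := [isSub for incidence_fun].
HB.instance Definition _ := [Choice of incidenceAlg by <:].
HB.instance Definition _ := [SubChoice_isSubLmodule of incidenceAlg by <:].

Implicit Types f g h : incidenceAlg.

Lemma incidence_out f x y : ~~ (x <= y)%O -> f (x, y) = 0.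
Proof. by case: f => f /= /asboolP; apply. Qed.

Lemma incidence_ext f g : (forall x y, (x <= y)%O -> f (x, y) = g (x, y)) -> f = g.
Proof.
move=> fg; apply/val_inj/funext => -[x y].
have [/fg //|xy] := boolP (x <= y)%O.
by rewrite [LHS]incidence_out // [RHS]incidence_out.
Qed.

Lemma incidenceDE f g p : (f + g) p = f p + g p. Proof. by []. Qed.
Lemma incidenceZE k f p : (k *: f) p = k * f p. Proof. by []. Qed.

Definition incidence_mul_fun f g (p : X * X) : F^o :=
  \sum_(z \in `[p.1, p.2]) f (p.1, z) * g (z, p.2).

Fact incidence_mul_subproof f g : incidence_mul_fun f g \in incident.
Proof.
apply/asboolP => x y xy; rewrite /incidence_mul_fun /= fsbig1 // => z.
rewrite /= in_itv /= => /andP[xz zy].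
by rewrite (le_trans xz zy) in xy.
Qed.

Definition incidence_mul f g := IncidenceAlg (incidence_mul_subproof f g).

Definition incidence_one_fun (p : X * X) : F^o := (p.1 == p.2)%:R.

Fact incidence_one_subproof : incidence_one_fun \in incident.
Proof.
apply/asboolP => x y xy; rewrite /incidence_one_fun /=.
by case: eqVneq xy => // ->; rewrite lexx.
Qed.

Definition incidence_one := IncidenceAlg incidence_one_subproof.

Lemma incidence_mulE f g x y a b : (a <= x)%O -> (y <= b)%O ->
  incidence_mul f g (x, y) =
    \sum_(z <- finmap.enum_fset (fset_set `[a, b])) f (x, z) * g (z, y).
Proof.
move=> ax yb; rewrite -fsbig_finite; last exact: locally_finite.
apply: fsbig_widen => z /=; rewrite !in_itv /=.
  by case/andP=> xz zy; rewrite (le_trans ax xz) (le_trans zy yb).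
case=> _ /negP; rewrite negb_and => /orP[]/incidence_out ->.
  by rewrite mul0r.
by rewrite mulr0.
Qed.

Fact incidence_mulA : associative incidence_mul.
Proof.
move=> f g h; apply: incidence_ext => x y xy.
rewrite (incidence_mulE _ _ (lexx x) (lexx y)).
rewrite [RHS](incidence_mulE _ _ (lexx x) (lexx y)).
have I z : z \in finmap.enum_fset (fset_set `[x, y]) -> (x <= z)%O && (z <= y)%O.
  by rewrite in_fset_set ?inE /= ?in_itv //; exact: locally_finite.
under eq_big_seq => z /I/andP[xz _].
  rewrite (incidence_mulE _ _ xz (lexx y)) mulr_sumr; over.
under [RHS]eq_big_seq => z /I/andP[_ zy].
  rewrite (incidence_mulE _ _ (lexx x) zy) mulr_suml; over.
rewrite /= exchange_big /=.
by apply: eq_bigr => z _; apply: eq_bigr => t _; rewrite mulrA.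
Qed.

Fact incidence_mul1 : left_id incidence_one incidence_mul.
Proof.
move=> f; apply: incidence_ext => x y xy; rewrite /= /incidence_mul_fun /=.
rewrite (fsbigD1 x) /=; last 2 first.
- exact: locally_finite.
- by rewrite in_itv /= lexx.
rewrite /incidence_one_fun /= eqxx mul1r fsbig1 ?addr0 // => z [_ /= /eqP].
by rewrite eq_sym => /negPf->; rewrite mul0r.
Qed.

Fact incidence_mulr1 : right_id incidence_one incidence_mul.
Proof.
move=> f; apply: incidence_ext => x y xy; rewrite /= /incidence_mul_fun /=.
rewrite (fsbigD1 y) /=; last 2 first.
- exact: locally_finite.
- by rewrite in_itv /= lexx andbT.
rewrite /incidence_one_fun /= eqxx mulr1 fsbig1 ?addr0 // => z [_ /= /eqP].
by move=> /negPf->; rewrite mulr0.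
Qed.

Fact incidence_mulDl : left_distributive incidence_mul +%R.
Proof.
move=> f g h; apply: incidence_ext => x y xy.
rewrite incidenceDE !(incidence_mulE _ _ (lexx x) (lexx y)) -big_split /=.
by apply: eq_bigr => z _; rewrite -mulrDl.
Qed.

Fact incidence_mulDr : right_distributive incidence_mul +%R.
Proof.
move=> f g h; apply: incidence_ext => x y xy.
rewrite incidenceDE !(incidence_mulE _ _ (lexx x) (lexx y)) -big_split /=.
by apply: eq_bigr => z _; rewrite -mulrDr.
Qed.

(* Only a possibly zero ring, since X may be empty; hence no algType
   instance, which requires 1 != 0. *)
HB.instance Definition _ := GRing.Zmodule_isPzRing.Build incidenceAlg
  incidence_mulA incidence_mul1 incidence_mulr1 incidence_mulDl incidence_mulDr.

Fact incidence_scaleAl k f g : k *: (f * g) = k *: f * g.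
Proof.
apply: incidence_ext => x y xy.
rewrite incidenceZE !(incidence_mulE _ _ (lexx x) (lexx y)) mulr_sumr.
by apply: eq_bigr => z _; rewrite incidenceZE mulrA.
Qed.

Fact incidence_scaleAr k f g : k *: (f * g) = f * (k *: g).
Proof.
apply: incidence_ext => x y xy.
rewrite incidenceZE !(incidence_mulE _ _ (lexx x) (lexx y)) mulr_sumr.
by apply: eq_bigr => z _; rewrite incidenceZE mulrCA.
Qed.

Definition derA : set {linear incidenceAlg -> incidenceAlg} :=
  [set D | forall f g, D (f * g) = D f * g + f * D g].

Definition derA_pred : {pred {linear incidenceAlg -> incidenceAlg}} :=
  mem derA.

Fact derA_submod_closed : submod_closed derA_pred.
Proof.
split=> [|k D E].
  by rewrite inE => f g; rewrite !linear0E mul0r mulr0 addr0.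
rewrite !inE => DP EP f g; rewrite !linearDE !linearZE DP EP.
rewrite mulrDl mulrDr scalerDr -incidence_scaleAl -incidence_scaleAr.
by rewrite addrACA.
Qed.

HB.instance Definition _ := GRing.isSubmodClosed.Build F
  {linear incidenceAlg -> incidenceAlg} derA_pred derA_submod_closed.

Record DerA := MkDerA {
  derA_val :> {linear incidenceAlg -> incidenceAlg};
  _ : derA_val \in derA_pred
}.

HB.instance Definition _ := [isSub for derA_val].
HB.instance Definition _ := [Choice of DerA by <:].
HB.instance Definition _ := [SubChoice_isSubLmodule of DerA by <:].

Definition M1 : set incidenceAlg := [set f | forall x, f (x, x) = 0].

Definition inner1DerA : set {linear incidenceAlg -> incidenceAlg} :=
  [set D : {linear _ -> _} | exists2 f, M1 f & forall g, D g = inner f g].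

Definition intervals := {p : X * X | (p.1 <= p.2)%O}.

Definition Co := {freeg intervals / F}.

(* Free on the pairs of basis elements, hence C (x) C. *)
Definition CoCo := {freeg (intervals * intervals)%type / F}.

HB.instance Definition _ := GRing.Lmodule.on Co.
HB.instance Definition _ := GRing.Lmodule.on CoCo.

(* The basis element [x, y], and 0 when x <= y fails. *)
Definition itvC (x y : X) : Co :=
  if insub (x, y) is Some i then << (i : intervals) >> else 0.

Definition tens (u v : Co) : CoCo :=
  fglift (fun i : intervals => fglift (fun j : intervals =>
    << (i, j) >> : CoCo) v) u.

(* phi (x) psi *)
Definition tensmap (phi psi : {linear Co -> Co}) : {linear CoCo -> CoCo} :=
  fglift (fun p : intervals * intervals =>
    tens (phi << p.1 >>) (psi << p.2 >>)).

Definition Delta : {linear Co -> CoCo} :=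
  fglift (fun i : intervals =>
    \sum_(z \in `[(val i).1, (val i).2])
      tens (itvC (val i).1 z) (itvC z (val i).2)).

Definition counit : {linear Co -> F^o} :=
  fglift (fun i : intervals => ((val i).1 == (val i).2)%:R : F^o).

Lemma itvCE (i : intervals) : itvC (val i).1 (val i).2 = << i >>.
Proof.
rewrite /itvC; have -> : ((val i).1, (val i).2) = val i by case: (val i).
by rewrite valK.
Qed.

Lemma itvC_out x y : ~~ (x <= y)%O -> itvC x y = 0.
Proof. by move=> xy; rewrite /itvC insubF //; apply: negbTE. Qed.

Lemma itvC_in x y (xy : (x <= y)%O) :
  itvC x y = << (exist _ (x, y) xy : intervals) >>.
Proof. exact: (itvCE (exist _ (x, y) xy)). Qed.

Lemma Delta_itvC x y :
  Delta (itvC x y) = \sum_(z \in `[x, y]) tens (itvC x z) (itvC z y).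
Proof.
have [xy|xy] := boolP (x <= y)%O.
  by rewrite (itvC_in xy) /Delta /= fglift1.
rewrite itvC_out // linear0 fsbig1 // => z /=; rewrite in_itv /= => /andP[xz zy].
by rewrite (le_trans xz zy) in xy.
Qed.

Lemma counit_itvC x y : counit (itvC x y) = (x == y)%:R.
Proof.
have [xy|xy] := boolP (x <= y)%O; first by rewrite (itvC_in xy) /= fglift1.
rewrite itvC_out // linear0; case: eqVneq xy => // ->; by rewrite lexx.
Qed.

Implicit Types (u v : Co) (phi psi nu : {linear Co -> Co}).

Fact tens_is_linearl v : linear (tens^~ v).
Proof. by move=> k a b; rewrite /tens linearP. Qed.

Fact tens_is_linearr u : linear (tens u).
Proof.
move=> k a b; rewrite /tens -[u]freeg_sumE !raddf_sum.
rewrite -big_split; apply: eq_bigr => i _ /=.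
by rewrite !liftU linearP /= scalerDr !scalerA [k * _]mulrC.
Qed.

HB.instance Definition _ u :=
  GRing.isLinear.Build F Co CoCo *:%R (tens u) (tens_is_linearr u).

Definition tensr v : Co -> CoCo := tens^~ v.

HB.instance Definition _ v :=
  GRing.isLinear.Build F Co CoCo *:%R (tensr v) (tens_is_linearl v).

Lemma tens0l v : tens 0 v = 0.
Proof. by have -> : tens 0 v = tensr v 0 by []; rewrite linear0. Qed.

Lemma tens0r u : tens u 0 = 0.
Proof. by rewrite linear0. Qed.

Lemma tensmapU phi psi (p : intervals * intervals) :
  tensmap phi psi << p >> = tens (phi << p.1 >>) (psi << p.2 >>).
Proof. by rewrite /tensmap /= fglift1. Qed.

Lemma tensmapE phi psi u v : tensmap phi psi (tens u v) = tens (phi u) (psi v).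
Proof.
have -> : tensmap phi psi (tens u v) = (tensmap phi psi \o tensr v) u by [].
have -> : tens (phi u) (psi v) = (tensr (psi v) \o phi) u by [].
congr (GRing.Linear.sort _ u); apply: freeg_ext => i /=.
have -> : tensmap phi psi (tensr v << i >>) = (tensmap phi psi \o tens << i >>) v by [].
have -> : tensr (psi v) (phi << i >>) = (tens (phi << i >>) \o psi) v by [].
congr (GRing.Linear.sort _ v); apply: freeg_ext => j /=.
by rewrite /tensmap /tens /= !fglift1.
Qed.

Lemma tensmap_linearl k phi psi nu c :
  tensmap (k *: phi + psi) nu c = k *: tensmap phi nu c + tensmap psi nu c.
Proof.
have -> : k *: tensmap phi nu c + tensmap psi nu c =
  (k *: tensmap phi nu + tensmap psi nu) c by [].
congr (GRing.Linear.sort _ c); apply: freeg_ext => p.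
by rewrite linearDE linearZE !tensmapU tens_is_linearl.
Qed.

Lemma tensmap_linearr k phi psi nu c :
  tensmap nu (k *: phi + psi) c = k *: tensmap nu phi c + tensmap nu psi c.
Proof.
have -> : k *: tensmap nu phi c + tensmap nu psi c =
  (k *: tensmap nu phi + tensmap nu psi) c by [].
congr (GRing.Linear.sort _ c); apply: freeg_ext => p.
by rewrite linearDE linearZE !tensmapU tens_is_linearr.
Qed.

Definition coDual := {linear Co -> F^o}.

HB.instance Definition _ := GRing.Lmodule.on coDual.

Implicit Types chi xi : coDual.

(* The linear form a (x) b |-> chi(a) xi(b). *)
Definition tens_form chi xi : {linear CoCo -> F^o} :=
  fglift (fun p : intervals * intervals => chi << p.1 >> * xi << p.2 >>).

Definition conv chi xi : coDual := tens_form chi xi \o Delta.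

Lemma tens_formE chi xi u v : tens_form chi xi (tens u v) = chi u * xi v.
Proof.
rewrite /tens -[u in RHS]freeg_sumE -[u in LHS]freeg_sumE !raddf_sum mulr_suml.
apply: eq_bigr => i _ /=; rewrite freegUZ !linearZ_LR -scalerAl; congr (_ *: _).
rewrite /= fglift1 -[v in RHS]freeg_sumE -[v in LHS]freeg_sumE !raddf_sum mulr_sumr.
apply: eq_bigr => j _ /=; rewrite freegUZ !linearZ_LR -scalerAr; congr (_ *: _).
by rewrite /= !fglift1.
Qed.

Definition Phi_fun chi (p : X * X) : F^o := chi (itvC p.1 p.2).

Fact Phi_subproof chi : Phi_fun chi \in incident.
Proof. by apply/asboolP => x y xy; rewrite /Phi_fun /= itvC_out ?linear0. Qed.

Definition Phi chi : incidenceAlg := IncidenceAlg (Phi_subproof chi).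

Fact Phi_is_linear : linear Phi.
Proof. by move=> k chi xi; apply: val_inj. Qed.

HB.instance Definition _ :=
  GRing.isLinear.Build F coDual incidenceAlg *:%R Phi Phi_is_linear.

Definition Psi f : coDual := fglift (fun i : intervals => f (val i)).

Fact Psi_is_linear : linear Psi.
Proof.
move=> k f g; apply: freeg_ext => i.
by rewrite linearDE linearZE /Psi /= !fglift1.
Qed.

HB.instance Definition _ :=
  GRing.isLinear.Build F incidenceAlg coDual *:%R Psi Psi_is_linear.

Lemma PhiK : cancel Phi Psi.
Proof.
move=> chi; apply: freeg_ext => i.
by rewrite /Psi /= fglift1 /= /Phi_fun itvCE.
Qed.

Lemma PsiK : cancel Psi Phi.
Proof.
move=> f; apply: incidence_ext => x y xy.
by rewrite /= /Phi_fun /= (itvC_in xy) /Psi /= fglift1.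
Qed.

Lemma PhiM chi xi : Phi (conv chi xi) = Phi chi * Phi xi.
Proof.
apply: incidence_ext => x y xy; rewrite /= /Phi_fun /conv /= Delta_itvC.
rewrite fsbig_finite; last exact: locally_finite.
rewrite raddf_sum /incidence_mul_fun /= fsbig_finite; last first.
  exact: locally_finite.
by apply: eq_bigr => z _; rewrite tens_formE.
Qed.

Lemma Phi1 : Phi counit = 1.
Proof. by apply: incidence_ext => x y _; rewrite /= /Phi_fun counit_itvC. Qed.

Fact conv_A : associative conv.
Proof.
by move=> a b c; apply: (can_inj PhiK); rewrite !PhiM mulrA.
Qed.
Fact conv_1l : left_id counit conv.
Proof. by move=> a; apply: (can_inj PhiK); rewrite PhiM Phi1 mul1r. Qed.
Fact conv_1r : right_id counit conv.
Proof. by move=> a; apply: (can_inj PhiK); rewrite PhiM Phi1 mulr1. Qed.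
Fact conv_Dl : left_distributive conv +%R.
Proof.
move=> a b c; apply: (can_inj PhiK); rewrite PhiM [RHS]raddfD.
by rewrite [Phi (a + b)]raddfD mulrDl /= !PhiM.
Qed.
Fact conv_Dr : right_distributive conv +%R.
Proof.
move=> a b c; apply: (can_inj PhiK); rewrite PhiM [RHS]raddfD.
by rewrite [Phi (b + c)]raddfD mulrDr /= !PhiM.
Qed.

HB.instance Definition _ := GRing.Zmodule_isPzRing.Build coDual
  conv_A conv_1l conv_1r conv_Dl conv_Dr.

Definition transpose_fun phi chi : coDual := chi \o phi.

Fact transpose_is_linear phi : linear (transpose_fun phi).
Proof. by move=> k a b; apply: linear_ext. Qed.

HB.instance Definition _ phi := GRing.isLinear.Build F coDual coDual *:%R
  (transpose_fun phi) (transpose_is_linear phi).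

Definition transpose phi : {linear coDual -> coDual} := transpose_fun phi.

Definition Theta phi : {linear incidenceAlg -> incidenceAlg} :=
  Phi \o transpose phi \o Psi.

Definition derC : set {linear Co -> Co} :=
  [set nu : {linear Co -> Co} | forall c, Delta (nu c) =
    tensmap nu idfun (Delta c) + tensmap idfun nu (Delta c)].

Definition derC_pred : {pred {linear Co -> Co}} := mem derC.

Fact derC_submod_closed : submod_closed derC_pred.
Proof.
split=> [|k nu mu].
  rewrite inE => c; rewrite linear0E linear0.
  suff [-> ->] : tensmap 0 idfun = 0 /\ tensmap idfun 0 = 0.
    by rewrite linear0E addr0.
  split; apply: freeg_ext => p; rewrite tensmapU.
    by rewrite [X in tens X _]linear0E tens0l.
  by rewrite [X in tens _ X]linear0E tens0r.
rewrite !inE => nuP muP c.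
have -> : (k *: nu + mu) c = k *: nu c + mu c by [].
have -> : Delta (k *: nu c + mu c) = k *: Delta (nu c) + Delta (mu c).
  by rewrite linearP.
rewrite [Delta (nu c)]nuP [Delta (mu c)]muP.
rewrite scalerDr addrACA; congr (_ + _); symmetry.
  exact: tensmap_linearl.
exact: tensmap_linearr.
Qed.

HB.instance Definition _ := GRing.isSubmodClosed.Build F
  {linear Co -> Co} derC_pred derC_submod_closed.

Record DerC := MkDerC {
  derC_val :> {linear Co -> Co};
  _ : derC_val \in derC_pred
}.

HB.instance Definition _ := [isSub for derC_val].
HB.instance Definition _ := [Choice of DerC by <:].
HB.instance Definition _ := [SubChoice_isSubLmodule of DerC by <:].

Definition innerDerC : set {linear Co -> Co} :=
  derC `&` [set nu : {linear Co -> Co} |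
    exists xi, forall chi, transpose nu chi = inner xi chi].

Definition inner1DerC : set {linear Co -> Co} :=
  derC `&` Theta @^-1` inner1DerA.

(* Only the values c x y with x < y matter. *)
Definition additive_system (c : X -> X -> F) :=
  forall x y z, (x < z)%O -> (z < y)%O -> c x y = c x z + c z y.

Definition addDerC : set {linear Co -> Co} :=
  derC `&` [set nu : {linear Co -> Co} | exists2 c, additive_system c &
    (forall x y, (x < y)%O -> nu (itvC x y) = c x y *: itvC x y) /\
    (forall x, nu (itvC x x) = 0)].

End Incidence.

Arguments M1 {d} X F _.
Arguments derA {d} X F _.
Arguments inner1DerA {d} X F _.
Arguments derC {d} X F _.
Arguments innerDerC {d} X F _.
Arguments inner1DerC {d} X F _.
Arguments addDerC {d} X F _.

(* Main.v *)
From HB Require Import structures.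
Require Import Defs.
From mathcomp Require Import all_boot all_order all_algebra.
From mathcomp Require Import all_classical.
From mathcomp.multinomials Require Import freeg.

(** Derivations of the incidence algebra [A] are rigid because the idempotents
    [e_x], the matrix units at the diagonal places [(x, x)], cut every [g] into
    scalars: [e_x g e_y = g(x, y) e_xy].  Applying a derivation [D] to this
    identity and reading it off at [(x, y)] gives
      [D(g)(x, y) =
         c(x, y) g(x, y) - (D(e_x) g)(x, y) - (g D(e_y))(x, y)],
    where [c(x, y) = D(e_xy)(x, y)].  Put [f(x, y) = D(e_x)(x, y)].  The
    relation [e_x e_y = 0] gives [D(e_y)(x, y) = - f(x, y)] for [x < y], and
    [e_x e_x = e_x] gives [f(x, x) = 0], so [f] lies in [M_1] and
      [D(g) = g f - f g + c g],
    the last product being taken entry by entry ([derA_decomp]).  The relation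
    [e_xz e_zy = e_xy] makes [c] additive ([derA_weight_add]).

    The value of the right-hand side at [(x, y)] involves only the finitely many
    values of [g] on subintervals of [[x, y]], so both terms are transposes
    of endomorphisms of the coalgebra [C], [coinner f] and [coweight c].
    The map [Theta] is injective, and it both preserves and reflects the
    property of being a derivation ([Theta_derP]), because functionals
    [chi (x) xi] separate the points of [C (x) C].  So the decomposition
    lifts to [C], and [Theta] is an isomorphism from [Der C] onto [Der A].
    The decomposition with [In] in place of [In_1] follows, since [In] contains
    [In_1].

    The sum is direct because the transpose of an additive derivation kills
    every [e_y], whereas the inner derivation of [f] takes [e_y] to a function whose value at
    [(x, y)] is [- f(x, y)] when [x < y]. *)

Set Implicit Arguments.
Unset Strict Implicit.
Unset Printing Implicit Defensive.

Import Order.TTheory GRing.Theory.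

Local Open Scope classical_set_scope.
Local Open Scope ring_scope.

Section IncidenceDerivations.
Variables (d : Order.disp_t) (X : locallyFinitePOrderType d) (F : fieldType).

Local Notation A := (incidenceAlg X F).
Local Notation C := (Co X F).
Implicit Types (f g h : A) (x y z a b : X) (nu mu : {linear C -> C}).
Implicit Types (D : {linear A -> A}) (chi xi : coDual X F) (c : X -> X -> F).

(** * The transpose map and derivations *)

Lemma Psi_itvC g x y : Psi g (itvC F x y) = g (x, y).
Proof. by rewrite -[in RHS](PsiK g). Qed.

Lemma linear_itvC_ext (U : lmodType F) (u v : {linear C -> U}) :
  (forall x y, (x <= y)%O -> u (itvC F x y) = v (itvC F x y)) -> u = v.
Proof. by move=> uv; apply: freeg_ext => -[[x y] xy]; rewrite -itvCE uv. Qed.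

Lemma ThetaE nu g x y : Theta nu g (x, y) = Psi g (nu (itvC F x y)).
Proof. by []. Qed.

Lemma Theta_is_linear : linear (@Theta d X F).
Proof.
move=> k nu mu; apply: linear_ext => g; apply: incidence_ext => x y _.
by rewrite linearDE linearZE incidenceDE incidenceZE !ThetaE linearP.
Qed.

Lemma Theta0 : @Theta d X F 0 = 0.
Proof.
by apply: linear_ext => g; apply: incidence_ext => x y _; rewrite ThetaE linear0.
Qed.

(** The coefficient functionals separate the points of [C]. *)
Lemma coDual_separates (u v : C) : (forall chi, chi u = chi v) -> u = v.
Proof.
move=> uv; apply/eqP/freeg_eqP => i.
pose chi : coDual X F := fglift (fun j : intervals X => (j == i)%:R : F^o).
have chiE w : chi w = coeff i w.
  rewrite -[in LHS](freeg_sumE w) -[in RHS](freeg_sumE w) !raddf_sum /=.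
  apply: eq_bigr => j _; rewrite freegUZ linearZ_LR coeffZ /= fglift1.
  by rewrite coeffU mul1r.
by rewrite -!chiE.
Qed.

(** Products of coefficient functionals are the coefficient functionals of the
    basis of [C (x) C]. *)
Lemma tens_form_separates (u v : CoCo X F) :
  (forall chi xi, tens_form chi xi u = tens_form chi xi v) -> u = v.
Proof.
move=> uv; apply/eqP/freeg_eqP => -[i j].
pose e (k : intervals X) : coDual X F :=
  fglift (fun l : intervals X => (l == k)%:R : F^o).
have eE w : tens_form (e i) (e j) w = coeff (i, j) w.
  rewrite -[in LHS](freeg_sumE w) -[in RHS](freeg_sumE w) !raddf_sum /=.
  apply: eq_bigr => -[k l] _; rewrite freegUZ linearZ_LR coeffZ /= fglift1.
  by rewrite /e /= !fglift1 coeffU mul1r -natrM mulnb -xpair_eqE.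
by rewrite -!eE.
Qed.

Lemma Theta_inj : injective (@Theta d X F).
Proof.
move=> nu mu E; apply: linear_itvC_ext => x y xy.
apply: coDual_separates => chi.
by rewrite -[chi]PhiK -!ThetaE E.
Qed.

Lemma Theta_Phi nu chi : Theta nu (Phi chi) = Phi (transpose nu chi).
Proof. by rewrite /Theta /= PhiK. Qed.

Lemma tens_form_tensmap chi xi nu mu w :
  tens_form chi xi (tensmap nu mu w) =
  tens_form (transpose nu chi) (transpose mu xi) w.
Proof.
have -> : tens_form chi xi (tensmap nu mu w)
          = (tens_form chi xi \o tensmap nu mu) w by [].
congr (GRing.Linear.sort _ w); apply: freeg_ext => p.
rewrite [LHS]/=.
have -> : fglift (fun q : intervals X * intervals X =>
   tens (nu << q.1 >>) (mu << q.2 >>)) << p >> =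
   tens (nu << p.1 >>) (mu << p.2 >>) :> CoCo X F by rewrite fglift1.
by rewrite tens_formE /= fglift1.
Qed.

Lemma tens_form_coleibniz chi xi nu (w : C) :
  tens_form chi xi
    (tensmap nu idfun (Delta X F w) + tensmap idfun nu (Delta X F w)) =
  conv (transpose nu chi) xi w + conv chi (transpose nu xi) w.
Proof.
have tid zeta : transpose idfun zeta = zeta by apply: linear_ext.
by rewrite linearD !tens_form_tensmap !tid.
Qed.

(** Pairing the coderivation rule with [chi (x) xi] yields the Leibniz rule for
    the transpose; the converse holds because these pairings separate the points
    of [C (x) C]. *)
Lemma Theta_derP nu : derC X F nu <-> derA X F (Theta nu).
Proof.
split=> [nuD f g|nuD w].
  rewrite -[f]PsiK -[g]PsiK -PhiM !Theta_Phi -!PhiM -raddfD; congr Phi.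
  by apply: linear_ext => w; rewrite linearDE -tens_form_coleibniz -nuD.
apply: tens_form_separates => chi xi; rewrite tens_form_coleibniz.
have := nuD (Phi chi) (Phi xi).
rewrite -PhiM !Theta_Phi -!PhiM -raddfD => /(can_inj (@PhiK d X F)).
by move=> /(congr1 (fun u : coDual X F => u w)).
Qed.

(** * Transposes of inner and of entrywise multiplication maps *)

(** The predual of [g |-> g f - f g]: pairing the sum with [g] replaces
    [[x, z]] by [g(x, z)] and [[z, y]] by [g(z, y)]. *)
Definition coinner f : {linear C -> C} :=
  fglift (fun i : intervals X => \sum_(z \in `[(val i).1, (val i).2])
    (f (z, (val i).2) *: itvC F (val i).1 z
     - f ((val i).1, z) *: itvC F z (val i).2)).

Lemma innerE f g p : inner f g p = (g * f) p - (f * g) p.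
Proof. by []. Qed.

Lemma Theta_coinner f g : Theta (coinner f) g = inner f g.
Proof.
apply: incidence_ext => x y xy.
rewrite innerE !(incidence_mulE _ _ (lexx x) (lexx y)) -sumrB.
rewrite ThetaE (itvC_in F xy) /coinner [X in Psi g X]fglift1.
rewrite fsbig_finite; last exact: locally_finite.
rewrite linear_sum; apply: eq_bigr => z _.
by rewrite linearB !(linearZ_LR (Psi g)) !Psi_itvC [X in X - _]mulrC.
Qed.

Definition coweight c : {linear C -> C} :=
  fglift (fun i : intervals X => c (val i).1 (val i).2 *: << i >>).

Lemma coweight_itvC c x y :
  coweight c (itvC F x y) = c x y *: itvC F x y.
Proof.
have [xy|xy] := boolP (x <= y)%O; last by rewrite itvC_out // linear0 scaler0.
by rewrite (itvC_in F xy) /coweight [LHS]fglift1.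
Qed.

Lemma Theta_coweight c g x y :
  Theta (coweight c) g (x, y) = c x y * g (x, y).
Proof. by rewrite ThetaE coweight_itvC linearZ_LR Psi_itvC. Qed.

(** * Matrix units *)

(** The test [x <= y] makes [munit x y] vanish for other pairs, so that the
    product formulas below hold for all [x] and [y]. *)
Definition munit_fun x y (p : X * X) : F^o := ((x <= y)%O && (p == (x, y)))%:R.

Fact munit_subproof x y : munit_fun x y \in @incident d X F.
Proof.
apply/asboolP => a b ab; rewrite /munit_fun.
case: andP => // -[xy /eqP[ax bY]]; by rewrite ax bY xy in ab.
Qed.

Definition munit x y : A := IncidenceAlg (munit_subproof x y).

Lemma munitE x y a b :
  munit x y (a, b) = ((x <= y)%O && ((a, b) == (x, y)))%:R.
Proof. by []. Qed.

Lemma incidence_mul_itvE g h a b :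
  (g * h) (a, b) = \sum_(z \in `[a, b]) g (a, z) * h (z, b).
Proof. by []. Qed.

(** At most the term at [x] survives in the sum over [[a, b]]; when [x] is
    outside that interval, both sides vanish. *)
Lemma munit_mulr g x y a b :
  (g * munit x y) (a, b) = g (a, x) * ((x <= y)%O && (b == y))%:R.
Proof.
rewrite incidence_mul_itvE.
have E z : munit x y (z, b) = ((x <= y)%O && (z == x) && (b == y))%:R.
  by rewrite munitE xpair_eqE andbA.
under eq_fsbigr => z _ do rewrite E.
have [/andP[ax xb]|nax] := boolP ((a <= x)%O && (x <= b)%O).
  rewrite (fsbigD1 x) /=; last 2 first.
  - exact: locally_finite.
  - by rewrite in_itv /= ax.
  rewrite eqxx andbT fsbig1 ?addr0 // => z [_ /= /eqP zx].
  by rewrite (negPf zx) andbF mulr0.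
rewrite fsbig1.
  move: nax; rewrite negb_and => /orP[/incidence_out ->|xb]; first by rewrite mul0r.
  case: eqP => [by_|_]; last by rewrite andbF mulr0.
  by rewrite -by_ (negPf xb) mulr0.
move=> z /=; rewrite in_itv /= => zI.
case: (z =P x) => [zx|_]; last by rewrite andbF mulr0.
by rewrite zx (negPf nax) in zI.
Qed.

Lemma munit_mull g x y a b :
  (munit x y * g) (a, b) = ((x <= y)%O && (a == x))%:R * g (y, b).
Proof.
rewrite incidence_mul_itvE.
have E z : munit x y (a, z) = ((x <= y)%O && (a == x) && (z == y))%:R.
  by rewrite munitE xpair_eqE andbA.
under eq_fsbigr => z _ do rewrite E.
have [/andP[ay yb]|nay] := boolP ((a <= y)%O && (y <= b)%O).
  rewrite (fsbigD1 y) /=; last 2 first.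
  - exact: locally_finite.
  - by rewrite in_itv /= ay.
  rewrite eqxx andbT fsbig1 ?addr0 // => z [_ /= /eqP zy].
  by rewrite (negPf zy) andbF mul0r.
rewrite fsbig1.
  move: nay; rewrite negb_and orbC => /orP[/incidence_out ->|ay].
    by rewrite mulr0.
  case: eqP => [ax|_]; last by rewrite andbF mul0r.
  by rewrite -ax (negPf ay) mul0r.
move=> z /=; rewrite in_itv /= => zI.
case: (z =P y) => [zy|_]; last by rewrite andbF mul0r.
by rewrite zy (negPf nay) in zI.
Qed.

Lemma munit_corner g x y : munit x x * g * munit y y = (g (x, y) : F) *: munit x y.
Proof.
apply: incidence_ext => a b ab.
rewrite munit_mulr munit_mull incidenceZE munitE xpair_eqE !lexx /=.
case: (a == x); last by rewrite andbF !mul0r mulr0.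
case: (b == y); last by rewrite !andbF !mulr0.
have [_|/incidence_out ->] := boolP (x <= y)%O; last by rewrite !mulr0 !mul0r.
by rewrite mul1r.
Qed.

Lemma munitM x y z : (x <= z)%O -> (z <= y)%O ->
  munit x z * munit z y = munit x y.
Proof.
move=> xz zy; apply: incidence_ext => a b ab.
rewrite munit_mull !munitE !xpair_eqE eqxx xz zy (le_trans xz zy) /=.
by rewrite -natrM mulnb.
Qed.

Lemma munit_orthogonal x y : x != y -> munit x x * munit y y = 0.
Proof.
move=> xy; apply: incidence_ext => a b ab.
by rewrite munit_mull munitE xpair_eqE (negPf xy) andbF mulr0.
Qed.

(** * Derivations of the incidence algebra *)

Section OneDerivation.
Variable D : {linear A -> A}.
Hypothesis D_der : derA X F D.

Definition derA_weight x y : F := D (munit x y) (x, y).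

Lemma derA_weight_diag x : derA_weight x x = 0.
Proof.
have := congr1 (fun h : A => h (x, x)) (D_der (munit x x) (munit x x)).
rewrite munitM // incidenceDE munit_mull munit_mulr lexx eqxx /= mul1r mulr1.
rewrite -[LHS]addr0 => /addrI /esym; exact.
Qed.

Lemma derA_weight_add : additive_system derA_weight.
Proof.
move=> x y z /ltW xz /ltW zy; rewrite {1}/derA_weight -(munitM xz zy) D_der.
by rewrite incidenceDE munit_mull munit_mulr !eqxx xz zy mul1r mulr1.
Qed.

Definition derA_potential_fun (p : X * X) : F^o := D (munit p.1 p.1) p.

Fact derA_potential_subproof : derA_potential_fun \in @incident d X F.
Proof. by apply/asboolP => x y xy; apply: incidence_out. Qed.

Definition derA_potential : A := IncidenceAlg derA_potential_subproof.

Lemma derA_potential_M1 : M1 X F derA_potential.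
Proof. exact: derA_weight_diag. Qed.

(** Orthogonality of the diagonal units [e_x] and [e_y]; on the diagonal both
    sides vanish. *)
Lemma derA_potential_col x y : D (munit y y) (x, y) = - derA_potential (x, y).
Proof.
have [<-|xy] := eqVneq x y.
  by rewrite derA_potential_M1 oppr0; apply: derA_weight_diag.
have := congr1 (fun h : A => h (x, y)) (D_der (munit x x) (munit y y)).
rewrite munit_orthogonal // linear0 incidenceDE munit_mull munit_mulr.
rewrite !lexx !eqxx mul1r mulr1 => /esym/eqP.
by rewrite addrC addr_eq0 => /eqP.
Qed.

(** The derivation applied to [e_x g e_y = g(x, y) e_xy], read at [(x, y)]. *)
Lemma derA_decomp g x y :
  D g (x, y) = inner derA_potential g (x, y) + derA_weight x y * g (x, y).
Proof.
have := congr1 (fun h : A => h (x, y)) (congr1 D (munit_corner g x y)).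
rewrite linearZ_LR incidenceZE !D_der incidenceDE !munit_mulr incidenceDE.
rewrite -mulrA !munit_mull !lexx !eqxx !mul1r mulr1.
have -> : (D (munit x x) * g) (x, y) = (derA_potential * g) (x, y).
  by rewrite !(incidence_mulE _ _ (lexx x) (lexx y)).
have -> : (g * D (munit y y)) (x, y) = - ((g * derA_potential) (x, y)).
  rewrite !(incidence_mulE _ _ (lexx x) (lexx y)) -sumrN.
  by apply: eq_bigr => z _; rewrite derA_potential_col mulrN.
rewrite -/(derA_weight x y) innerE [derA_weight x y * _]mulrC => <-.
by rewrite addrC subrKA addrAC subrr add0r.
Qed.

Lemma derA_Theta :
  Theta (coinner derA_potential + coweight derA_weight) = D.
Proof.
apply: linear_ext => g; apply: incidence_ext => x y _.
rewrite derA_decomp -Theta_coinner -Theta_coweight !ThetaE.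
by rewrite linearDE linearD.
Qed.

End OneDerivation.

(** * Derivations of the incidence coalgebra *)

Lemma inner_der f g h : inner f (g * h) = inner f g * h + g * inner f h.
Proof. by rewrite /inner mulrBl mulrBr !mulrA [RHS]addrC subrKA. Qed.

Lemma coinner_der f : derC X F (coinner f).
Proof. by apply/Theta_derP => g h; rewrite !Theta_coinner inner_der. Qed.

Lemma derC_D nu mu : derC X F nu -> derC X F mu -> derC X F (nu + mu).
Proof.
move=> nuD muD; have [_ cl] := @derC_submod_closed d X F.
have : 1 *: nu + mu \in @derC_pred d X F by apply: cl; rewrite inE.
by rewrite scale1r inE.
Qed.

Lemma derC_B nu mu : derC X F nu -> derC X F mu -> derC X F (nu - mu).
Proof.
move=> nuD muD; have [_ cl] := @derC_submod_closed d X F.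
have : -1 *: mu + nu \in @derC_pred d X F by apply: cl; rewrite inE.
by rewrite scaleN1r addrC inE.
Qed.

Lemma derC_inner1_add nu : derC X F nu ->
  exists2 mu, inner1DerC X F mu &
    exists2 lambda, addDerC X F lambda & nu = mu + lambda.
Proof.
move=> nuD; have TD : derA X F (Theta nu) by apply/Theta_derP.
have /esym E := Theta_inj (derA_Theta TD).
exists (coinner (derA_potential (Theta nu))).
  split; first exact: coinner_der.
  exists (derA_potential (Theta nu)); first exact: derA_potential_M1.
  by move=> g; rewrite Theta_coinner.
exists (coweight (derA_weight (Theta nu))) => //; split.
  have := derC_B nuD (coinner_der (derA_potential (Theta nu))).
  by rewrite {1}E addrAC subrr add0r.
exists (derA_weight (Theta nu)); first exact: derA_weight_add.
split=> [x y _|x]; first exact: coweight_itvC.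
by rewrite coweight_itvC derA_weight_diag // scale0r.
Qed.

Lemma inner1DerC_innerDerC : inner1DerC X F `<=` innerDerC X F.
Proof.
move=> nu [nuD [f _ nuf]]; split=> //.
exists (Psi f) => chi; apply: (can_inj (@PhiK d X F)).
by rewrite -Theta_Phi nuf /inner raddfB /= !PhiM PsiK.
Qed.

(** Both descriptions of [Theta nu] are compared on the diagonal unit [e_y], at
    [(x, y)] with [x < y]. *)
Lemma inner1DerC_addDerC_eq0 nu :
  inner1DerC X F nu -> addDerC X F nu -> nu = 0.
Proof.
move=> [_ [f fM1 nuf]] [_ [c _ [nuc _]]].
suff f0 : f = 0.
  apply: Theta_inj; apply: linear_ext => g.
  by rewrite nuf f0 /inner mulr0 mul0r subr0 Theta0.
apply: incidence_ext => x y; rewrite le_eqVlt => /orP[/eqP<-|xy].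
  exact: fM1.
have := congr1 (fun h : A => h (x, y)) (nuf (munit y y)).
rewrite ThetaE nuc // linearZ_LR Psi_itvC munitE xpair_eqE (lt_eqF xy) andbF.
rewrite [LHS]mulr0 innerE munit_mull (lt_eqF xy) andbF mul0r add0r.
rewrite munit_mulr lexx eqxx mulr1 => /esym/eqP.
by rewrite oppr_eq0 => /eqP.
Qed.

Lemma inner1DerC0 : inner1DerC X F 0.
Proof.
split; first by have [/[!inE]] := @derC_submod_closed d X F.
exists 0 => // g; by rewrite Theta0 /inner mulr0 mul0r subr0.
Qed.

Lemma addDerC0 : addDerC X F 0.
Proof.
split; first by have [/[!inE]] := @derC_submod_closed d X F.
exists (fun _ _ => 0); first by move=> x y z _ _; rewrite addr0.
by split=> // x y _; rewrite scale0r.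
Qed.

(** * The isomorphism between the derivation spaces *)

Fact Theta_der_subproof (nu : DerC X F) : Theta nu \in @derA_pred d X F.
Proof.
by rewrite inE; apply/Theta_derP; have := valP nu; rewrite inE.
Qed.

Definition Theta_der (nu : DerC X F) : DerA X F := MkDerA (Theta_der_subproof nu).

Fact Theta_der_is_linear : linear Theta_der.
Proof. by move=> k nu mu; apply: val_inj; apply: Theta_is_linear. Qed.

HB.instance Definition _ :=
  GRing.isLinear.Build F (DerC X F) (DerA X F) *:%R Theta_der
    Theta_der_is_linear.

Lemma Theta_der_bij : bijective Theta_der.
Proof.
pose inv D := coinner (derA_potential D) + coweight (derA_weight D).
have invP (D : DerA X F) : inv D \in @derC_pred d X F.
  have := valP D; rewrite !inE => DD.
  by apply/Theta_derP; rewrite derA_Theta.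
have invK : cancel (fun D : DerA X F => MkDerC (invP D)) Theta_der.
  by move=> D; apply: val_inj; apply: derA_Theta; have := valP D; rewrite inE.
exists (fun D : DerA X F => MkDerC (invP D)) => // nu.
by apply: val_inj; apply: Theta_inj; apply: (congr1 val (invK (Theta_der nu))).
Qed.

End IncidenceDerivations.

Theorem theorem12p1 (d : Order.disp_t) (X : locallyFinitePOrderType d)
    (F : fieldType) :
  [/\ derC X F =
        [set nu + lambda | nu in innerDerC X F & lambda in addDerC X F],
      derC X F =
        [set nu + lambda | nu in inner1DerC X F & lambda in addDerC X F],
      inner1DerC X F `&` addDerC X F = [set 0]
    & exists iso : {linear DerC X F -> DerA X F}, bijective iso].
Proof.
split.
- apply/seteqP; split=> [nu /derC_inner1_add[mu muP [lambda lambdaP ->]]|].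
    by exists mu; [exact: inner1DerC_innerDerC|exists lambda].
  by move=> _ [mu [muD _] [lambda [lambdaD _] <-]]; apply: derC_D.
- apply/seteqP; split=> [nu /derC_inner1_add[mu muP [lambda lambdaP ->]]|].
    by exists mu => //; exists lambda.
  by move=> _ [mu [muD _] [lambda [lambdaD _] <-]]; apply: derC_D.
- apply/seteqP; split=> [nu [] |_ ->]; first exact: inner1DerC_addDerC_eq0.
  by split; [exact: inner1DerC0|exact: addDerC0].
- by exists (@Theta_der d X F); apply: Theta_der_bij.
Qed.
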